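(* Let $\Gamma$ be a triangulation of a connected closed $2$-dimensional (not necessarily orientable) surface. Let $\mathrm{G}_1$ be the subgraph of the dual graph $\Gamma^{*}$ induced on the set of faces $F$ of $\Gamma$ whose $z$-monodromy $M_F$ is the identity, and let $\mathrm{G}_2$ be the subgraph of $\Gamma^{*}$ induced on the set of faces $F$ whose $z$-monodromy satisfies $M_F=D_F$. Then $\mathrm{G}_1$ and $\mathrm{G}_2$ are forests.
   Context: A triangulation of a surface $M$ is a closed $2$-cell embedding of a finite connected graph in $M$ such that every face contains exactly three edges, every edge lies in exactly two distinct faces, and the intersection of two distinct faces is an edge, a vertex, or empty. A zigzag is a sequence of edges $\{e_i\}_{i\in\mathbb N}$ such that for every $i$: $e_i,e_{i+1}$ share a vertex and lie in a common face; the faces containing $e_i,e_{i+1}$ and $e_{i+1},e_{i+2}$ are distinct, and $e_i,e_{i+2}$ are disjoint. It is cyclic and is written $e_1,\dots,e_n$ with minimal period $n$; a zigzag traverses each of its edges in a definite direction (consecutive edges share a vertex), and any two consecutive oriented edges determine the zigzag uniquely. For a face $F$ with vertices $a,b,c$, let $\Omega(F)=\{ab,bc,ca,ac,cb,ba\}$ be its set of oriented edges ($xy$ is the edge from $x$ to $y$) and $D_F$ the permutation $(ab,bc,ca)(ac,cb,ba)$ of $\Omega(F)$. The $z$-monodromy $M_F$ is the permutation of $\Omega(F)$ defined as follows: for $e\in\Omega(F)$ take $e_0\in\Omega(F)$ with $D_F(e_0)=e$, consider the zigzag containing the consecutive oriented edges $e_0,e$, and let $M_F(e)$ be the first element of $\Omega(F)$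 (edge of $F$ with the direction in which the zigzag traverses it) occurring in this zigzag after $e$. The dual graph $\Gamma^*$ has the faces of $\Gamma$ as vertices, two faces being adjacent iff they share an edge. *)

(* Defs.v *)
From mathcomp Require Import all_boot all_order all_algebra.
From mathcomp Require Import all_classical all_reals all_analysis.
Import Order.TTheory GRing.Theory Num.Theory numFieldNormedType.Exports.

Set Implicit Arguments.
Unset Strict Implicit.
Unset Printing Implicit Defensive.

Local Open Scope classical_set_scope.
Local Open Scope ring_scope.

(* Set notations marked %SET denote finite sets over a finType; all others denote
   classical sets. *)

Definition homeomorphism_on (T U : topologicalType) (A : set T) (B : set U)
    (f : T -> U) : Prop :=
  set_bij A B f /\ {within A, continuous f} /\
  exists g : U -> T, {within B, continuous g} /\ (forall x, A x -> g (f x) = x).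

Definition closed_surface (R : realType) (M : topologicalType) : Prop :=
  [/\ hausdorff_space M, @second_countable M, compact [set: M],
      [set: M] !=set0 /\ connected [set: M]
    & forall p : M, exists (U : set M) (f : M -> R * R),
        [/\ open U, U p & homeomorphism_on U [set: R * R] f]].

Definition closed_disc (R : realType) : set (R * R) :=
  [set p | p.1 ^+ 2 + p.2 ^+ 2 <= 1].
Definition open_disc (R : realType) : set (R * R) :=
  [set p | p.1 ^+ 2 + p.2 ^+ 2 < 1].
Definition unit_circle (R : realType) : set (R * R) :=
  [set p | p.1 ^+ 2 + p.2 ^+ 2 = 1].

Definition is_arc (R : realType) (M : topologicalType) (p q : M) (A : set M) :
    Prop :=
  exists g : R -> M,
    [/\ homeomorphism_on [set t : R | 0 <= t <= 1] A g, g 0 = p & g 1 = q].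

(* An edge is represented by the set of its two ends, and [arc e] is the set of
   points of M that it occupies. *)
Record embedded_graph (R : realType) (M : topologicalType) := EmbeddedGraph {
  vert : finType;
  edges : {set {set vert}};
  pos : vert -> M;
  arc : {set vert} -> set M;
  card_edge : forall e, e \in edges -> #|e| = 2%N;
  graph_connected :
    forall x y : vert, connect (fun u v => [set u; v]%SET \in edges) x y;
  pos_inj : injective pos;
  arcP : forall x y : vert, [set x; y]%SET \in edges ->
    is_arc R (pos x) (pos y) (arc [set x; y]%SET);
  arc_pos : forall e x, e \in edges -> arc e (pos x) -> x \in e;
  arc_meet : forall e f, e \in edges -> f \in edges -> e <> f ->
    arc e `&` arc f `<=` range pos
}.

Section Embedding.
Context (R : realType) (M : topologicalType) (G : embedded_graph R M).

Definition adj (x y : vert G) : bool := [set x; y]%SET \in edges G.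

Definition carrier : set M :=
  [set p | range (@pos R M G) p \/ exists2 e, e \in edges G & arc e p].

(* Faces are the connected components of M minus the graph; a vertex or an edge
   is contained in a face when it lies in the closure of the component. *)
Definition is_face (F : set M) : Prop :=
  exists2 p, ~ carrier p & F = connected_component (~` carrier) p.

Definition face_edges (F : set M) : {set {set vert G}} :=
  [set e in edges G | `[< arc e `<=` closure F >]]%SET.

Definition face_verts (F : set M) : {set vert G} :=
  [set v | `[< closure F (pos v) >]]%SET.

(* Each face, with its closure, is an open disc in a closed disc, and is bounded
   by a cycle s of the graph. *)
Definition closed_2cell_embedding : Prop :=
  forall F, is_face F -> exists h : R * R -> M,
    [/\ homeomorphism_on (@closed_disc R) (closure F) h,
        h @` @open_disc R = F
      & exists s : seq (vert G),
          [/\ (2 < size s)%N, uniq s, cycle adj s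
            & h @` @unit_circle R =
              \bigcup_(x in [set` s]) arc [set x; next s x]%SET]].

Definition triangulation : Prop :=
  [/\ closed_2cell_embedding,
      forall F, is_face F -> #|face_edges F| = 3%N,
      forall e, e \in edges G -> exists F1 F2, F1 <> F2 /\
        forall F, (is_face F /\ e \in face_edges F) <-> (F = F1 \/ F = F2)
    & forall F1 F2, is_face F1 -> is_face F2 -> F1 <> F2 ->
        [\/ exists2 e, e \in edges G & closure F1 `&` closure F2 = arc e,
            exists v : vert G, closure F1 `&` closure F2 = [set pos v]
          | closure F1 `&` closure F2 = set0]].

Definition zigzag (e : nat -> {set vert G}) : Prop :=
  forall i : nat,
    [/\ e i \in edges G,
        exists x, x \in e i /\ x \in e i.+1,
        exists2 F, is_face F & e i \in face_edges F /\ e i.+1 \in face_edges F,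
        forall F F', is_face F -> is_face F' ->
          e i \in face_edges F -> e i.+1 \in face_edges F ->
          e i.+1 \in face_edges F' -> e i.+2 \in face_edges F' -> F <> F'
      & forall x, ~ (x \in e i /\ x \in e i.+2)].

Definition oriented_edge : Type := (vert G * vert G)%type.

Definition ends (u : oriented_edge) : {set vert G} := [set u.1; u.2]%SET.

(* The direction in which a zigzag traverses its edges: each edge is left
   through the vertex shared with the next one. *)
Definition oriented_zigzag (z : nat -> oriented_edge) : Prop :=
  zigzag (fun i => ends (z i)) /\ forall i, (z i).2 = (z i.+1).1.

Definition Omega (F : set M) (u : oriented_edge) : Prop :=
  ends u \in face_edges F.

(* Permutations of [Omega F] are given by their graphs.  Letting (a, b, c) range
   over all orderings of the vertices of F yields both 3-cycles of D_F. *)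
Definition D (F : set M) (u v : oriented_edge) : Prop :=
  exists a b c : vert G,
    [/\ uniq [:: a; b; c], face_verts F = [set a; b; c]%SET,
        u = (a, b) & v = (b, c)].

(* [z_monodromy F u v] means M_F(u) = v; a two-sided cyclic zigzag is determined
   by, and read off from, its forward part starting at u0, u. *)
Definition z_monodromy (F : set M) (u v : oriented_edge) : Prop :=
  exists u0 z n,
    [/\ D F u0 u, oriented_zigzag z, z 0%N = u0 /\ z 1%N = u,
        [/\ (1 < n)%N, z n = v & Omega F v]
      & forall k, (1 < k < n)%N -> ~ Omega F (z k)].

Definition z_monodromy_is_id (F : set M) : Prop :=
  forall u v, z_monodromy F u v <-> (Omega F u /\ v = u).

Definition z_monodromy_is_D (F : set M) : Prop :=
  forall u v, z_monodromy F u v <-> D F u v.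

Definition dual_adj (F1 F2 : set M) : Prop :=
  [/\ is_face F1, is_face F2, F1 <> F2
    & exists e, e \in face_edges F1 /\ e \in face_edges F2].

End Embedding.

Definition induced_subgraph (T : Type) (r : T -> T -> Prop) (A : set T) : T -> T -> Prop :=
  fun x y => [/\ A x, A y & r x y].

(* [r] is the (symmetric, irreflexive) adjacency relation of a simple graph. *)
Definition forest (T : choiceType) (r : T -> T -> Prop) : Prop :=
  forall s : seq T, (2 < size s)%N -> uniq s ->
    ~ cycle (fun x y => `[< r x y >]) s.

(* Main.v *)
(** Two faces share at most one edge and every edge lies in exactly two faces, so
    a zigzag running along an edge of F turns inside F either just before or just
    after that edge, never both.  Let a path of faces go from F = abc to
    F' = bcd across bc.  If the monodromies are the identity, attach to this
    crossing the time needed by the zigzag ab, bc to come back to bc; if they are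
    D_F, attach the time needed by the zigzag bc, ca to come back to ab, bc.
    The returns of the same zigzag to F' are nested inside that
    time interval, so the number attached to the crossing out of F', through cd
    or db, is strictly smaller.  A cycle of faces would give an infinite
    descent. *)

Require Import Defs.
From mathcomp Require Import all_boot all_order all_algebra.
From mathcomp Require Import all_classical all_reals all_analysis.
From mathcomp Require Import zify.
Import Order.TTheory GRing.Theory Num.Theory.
Import Defs.

Set Implicit Arguments.
Unset Strict Implicit.
Unset Printing Implicit Defensive.

Local Open Scope classical_set_scope.

(** * Successors in a cyclic list, and unordered pairs *)

Lemma next_next_neq (T : eqType) (s : seq T) (x : T) :
  (2 < size s)%N -> uniq s -> x \in s -> next s (next s x) != x.
Proof.
move=> s2 us xs; have [i s' def_s] := rot_to xs.
rewrite -!(next_rot i us) def_s.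
have : (2 < size (x :: s'))%N by rewrite -def_s size_rot.
have : uniq (x :: s') by rewrite -def_s rot_uniq.
case: s' {def_s} => [|y [|w s']] //= /andP[xN /andP[yN _]] _.
move: xN yN; rewrite !inE !negb_or => /and3P[xy xw _] /andP[yw _].
by rewrite eqxx /= eqxx [y == x]eq_sym (negPf xy) eq_sym.
Qed.

Lemma set2_eqP {T : finType} (x y x' y' : T) :
  [set x; y]%SET = [set x'; y']%SET ->
  (x = x' /\ y = y') \/ (x = y' /\ y = x').
Proof.
move=> E.
have := finset.set21 x y; have := finset.set22 x y; rewrite E !inE.
have := finset.set21 x' y'; have := finset.set22 x' y'; rewrite -E !inE.
by do 4![case/orP=> /eqP ?]; subst; auto.
Qed.

Section Triangulation.
Context {R : realType} {M : topologicalType} {G : embedded_graph R M}.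
Context (hG : triangulation G).
Implicit Types (F : set M) (a b c d : vert G) (u v : oriented_edge G).

(** * Faces as triangles, and [D] as a permutation *)

Lemma arc_end (e : {set vert G}) x : e \in edges G -> x \in e -> arc e (pos x).
Proof.
move=> eE xe; have [p [q [pq def_e]]] := finset.cards2P _ (introT eqP (card_edge eE)).
move: eE xe; rewrite def_e => eE xe.
have [g [[[gf _ _] _] g0 g1]] := arcP eE.
move: xe; rewrite !inE => /orP[] /eqP->.
- by rewrite -g0; apply: gf; rewrite /= lexx ler01.
- by rewrite -g1; apply: gf; rewrite /= lexx ler01.
Qed.

Lemma arc_sub_eq (e f : {set vert G}) : e \in edges G -> f \in edges G ->
  arc f `<=` arc e -> f = e.
Proof.
move=> eE fE fe; apply/eqP; rewrite eqEcard (card_edge eE) (card_edge fE) leqnn.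
rewrite andbT; apply/fintype.subsetP => x xf.
exact: (arc_pos eE (fe _ (arc_end fE xf))).
Qed.

Lemma face_edgesP F e :
  e \in face_edges G F <-> e \in edges G /\ arc e `<=` closure F.
Proof.
rewrite !inE; split=> [/andP[? /asboolP]|[-> ?]] //=.
by apply/asboolP.
Qed.

(** The edges of the bounding cycle are distinct sides of the face, so the cycle has at most three
    vertices, hence exactly three, and its edges are all the sides. *)
Lemma face_triangle F : is_face G F -> exists a b c,
  [/\ uniq [:: a; b; c], face_verts G F = [set a; b; c]%SET
    & forall e, (e \in face_edges G F) =
        (e \in [:: [set a; b]; [set b; c]; [set c; a]]%SET)].
Proof.
move=> fF; have [cell card3 _ _] := hG.
have [h [[[hf _ hs] _] hO [s [s2 us cs hC]]]] := cell F fF.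
have cyc x : x \in s -> adj x (next s x) by apply: next_cycle.
pose k x := [set x; next s x]%SET.
have arck x : x \in s -> arc (k x) `<=` h @` @unit_circle R.
  by move=> xs; rewrite hC => p pA; exists x.
have clos_circ : h @` @unit_circle R `<=` closure F.
  by move=> _ [p pC <-]; apply: hf; rewrite /closed_disc /= pC.
have kF x : x \in s -> k x \in face_edges G F.
  move=> xs; apply/face_edgesP; split; first exact: cyc.
  exact: subset_trans (arck x xs) clos_circ.
have kinj : {in s &, injective k}.
  move=> x y xs ys /set2_eqP[[]//|[xy yx]].
  by have := next_next_neq s2 us ys; rewrite -xy yx eqxx.
have umap : uniq (map k s) by rewrite map_inj_in_uniq.
have subF : {subset map k s <= enum (face_edges G F)}.
  by move=> _ /mapP[x xs ->]; rewrite mem_enum kF.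
have sz : size s = 3.
  apply/eqP; rewrite eqn_leq s2 andbT -(size_map k) -(card3 F fF) cardE.
  exact: uniq_leq_size.
have eqF : map k s =i enum (face_edges G F).
  by apply: (uniq_min_size umap subF _).2; rewrite size_map sz -cardE card3.
have vF x : (x \in face_verts G F) = (x \in s).
  rewrite inE; apply/asboolP/idP => [|xs]; last first.
    apply: clos_circ; apply: (arck x xs); apply: arc_end; first exact: cyc.
    by rewrite finset.set21.
  (* The open disc maps onto F, which avoids the graph, so a vertex in the closure comes from the
     circle. *)
  move=> /hs[p pD hp].
  have circ : (h @` @unit_circle R) (pos x).
    exists p => //; apply/eqP; rewrite eq_le pD /= leNgt; apply/negP => pO.
    have : F (pos x) by rewrite -hO; exists p.
    case: fF => q _ -> /connected_component_sub; apply.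
    by left; exists x.
  move: circ; rewrite hC => -[y ys /(arc_pos (cyc y ys))].
  by rewrite !inE => /orP[] /eqP-> //; rewrite mem_next.
clear hC subF umap kinj kF arck cyc cs s2; rewrite /k {k} in eqF.
case: s sz us vF eqF => [|a [|b [|c []]]] //= _ us vF.
have [ab bc ca] : [/\ a != b, b != c & c != a].
  move: us; rewrite /= !inE negb_or (eq_sym c a).
  by case/and3P=> /andP[-> ->] ->.
move: (ab) (bc) (ca); rewrite eq_sym => ba; rewrite eq_sym => cb; rewrite eq_sym => ac.
rewrite !(eqxx, negPf ab, negPf ba, negPf bc, negPf cb, negPf ca, negPf ac).
move=> eqF; exists a, b, c; split => //.
- by apply/setP => x; rewrite vF !inE orbA.
- by move=> e; rewrite eqF mem_enum.
Qed.

Lemma card_face_verts F : is_face G F -> #|face_verts G F| = 3.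
Proof.
move=> /face_triangle[a [b [c [us -> _]]]].
rewrite -finset.setUA finset.cardsU1 finset.cards2 !inE negb_or.
by move: us; rewrite /= !inE negb_or => /and3P[/andP[-> ->] -> _].
Qed.

(** Three vertices form only three pairs, all of them sides; this reduces [Omega] and [D] to
    conditions on vertices. *)
Lemma face_edgesE F e : is_face G F ->
  (e \in face_edges G F) = (e \subset face_verts G F) && (#|e| == 2).
Proof.
move=> /face_triangle[a [b [c [us -> ->]]]].
have [ab bc ca] : [/\ a != b, b != c & c != a].
  move: us; rewrite /= !inE negb_or (eq_sym c a).
  by case/and3P=> /andP[-> ->] ->.
apply/idP/andP => [|[sub /finset.cards2P[p [q [pq E]]]]].
  rewrite !inE => /or3P[] /eqP->; rewrite finset.cards2 ?ab ?bc ?ca; split=> //;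
  by apply/fintype.subsetP => x; rewrite !inE => /orP[] ->; rewrite ?orbT.
move: sub pq; rewrite E finset.subUset !finset.sub1set !inE -!orbA => /andP[].
have sw (x y : vert G) : [set x; y]%SET = [set y; x]%SET := finset.setUC _ _.
by do 2![case/or3P=> /eqP->];
  rewrite ?(sw b a) ?(sw c b) ?(sw a c) ?eqxx ?orbT.
Qed.

Lemma OmegaP F u : is_face G F ->
  Omega F u <-> [/\ u.1 \in face_verts G F, u.2 \in face_verts G F & u.1 <> u.2].
Proof.
move=> fF; rewrite /Omega face_edgesE // /ends finset.subUset !finset.sub1set finset.cards2.
case: (u.1 =P u.2) => /= [->|ne]; first by split=> [/andP[]|[]].
by rewrite andbT; split=> [/andP[]|[-> ->]].
Qed.

Lemma DP F u v : is_face G F -> D F u v <->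
  [/\ Omega F u, Omega F v, u.2 = v.1 & u.1 <> v.2].
Proof.
move=> fF; split=> [[a [b [c [us E -> ->]]]]|].
  move: us; rewrite /= !inE negb_or => /and3P[/andP[ab ac] bc _].
  have [aV bV cV] : [/\ a \in face_verts G F, b \in face_verts G F & c \in face_verts G F].
    by rewrite E !inE !eqxx ?orbT.
  by split=> //=; [apply/OmegaP => //; split=> //=; apply/eqP..|apply/eqP].
case: u v => [a b] [b' c] [/(OmegaP _ fF)[/= aV bV ab]].
move=> /(OmegaP _ fF)[/= _ cV bc] ?; subst b'; move=> ac.
have us : uniq [:: a; b; c].
  rewrite /= !inE negb_or; apply/and3P; split=> //; last exact/eqP.
  by apply/andP; split; apply/eqP.
exists a, b, c; split=> //; apply/esym/eqP; rewrite eqEcard; apply/andP; split.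
  by rewrite !finset.subUset !finset.sub1set aV bV cV.
rewrite card_face_verts // -finset.setUA finset.cardsU1 finset.cards2 !inE negb_or.
by move: us; rewrite /= !inE negb_or => /and3P[/andP[-> ->] -> _].
Qed.

Lemma D_fun F u v v' : D F u v -> D F u v' -> v = v'.
Proof.
move=> [a [b [c [us E -> ->]]]] [a' [b' [c' [us' E' Eab ->]]]].
case: Eab us' E' => <- <- us' E'.
congr (_, _); move: us us'; rewrite /= !inE !negb_or.
move=> /and3P[/andP[_ ac] bc _] /and3P[/andP[_ ac'] bc' _].
have : c \in [set a; b; c']%SET by rewrite -E' E !inE eqxx orbT.
by rewrite !inE (eq_sym c a) (eq_sym c b) (negPf ac) (negPf bc) => /eqP.
Qed.

Lemma D_inj F u u' v : D F u v -> D F u' v -> u = u'.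
Proof.
move=> [a [b [c [us E -> ->]]]] [a' [b' [c' [us' E' -> [? ?]]]]]; subst b' c'.
congr (_, _); move: us us'; rewrite /= !inE !negb_or.
move=> /and3P[/andP[ab ac] _ _] /and3P[/andP[ab' ac'] _ _].
have : a \in [set a'; b; c]%SET by rewrite -E' E !inE eqxx.
by rewrite !inE (negPf ab) (negPf ac) !orbF => /eqP.
Qed.

Lemma shared_edge_eq F F' e f : is_face G F -> is_face G F' -> F <> F' ->
  e \in face_edges G F -> e \in face_edges G F' ->
  f \in face_edges G F -> f \in face_edges G F' -> e = f.
Proof.
move=> fF fF' FF' /face_edgesP[eE eF] /face_edgesP[_ eF'].
move=> /face_edgesP[fE fcF] /face_edgesP[_ fcF'].
have [_ _ _ /(_ F F' fF fF' FF')] := hG.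
have eI : arc e `<=` closure F `&` closure F' by move=> p pe; split; auto.
have fI : arc f `<=` closure F `&` closure F' by move=> p pe; split; auto.
case=> [[g gE E]|[v E]|E].
- by rewrite E in eI fI; rewrite (arc_sub_eq gE eE eI) (arc_sub_eq gE fE fI).
- have [p [q [pq def_e]]] := finset.cards2P _ (introT eqP (card_edge eE)).
  have ends_v x : x \in e -> x = v.
    by move=> xe; have := eI _ (arc_end eE xe); rewrite E => /pos_inj.
  have pv : p = v by apply: ends_v; rewrite def_e finset.set21.
  have qv : q = v by apply: ends_v; rewrite def_e finset.set22.
  by rewrite pv qv eqxx in pq.
- have [p [q [pq def_e]]] := finset.cards2P _ (introT eqP (card_edge eE)).
  have pe : p \in e by rewrite def_e finset.set21.
  by have := eI _ (arc_end eE pe); rewrite E.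
Qed.

Lemma edge_faces F F' F'' e : is_face G F -> is_face G F' -> is_face G F'' ->
  F <> F' -> e \in face_edges G F -> e \in face_edges G F' -> e \in face_edges G F'' ->
  F'' = F \/ F'' = F'.
Proof.
move=> fF fF' fF'' FF' eF eF' eF''.
have /face_edgesP[eE _] := eF; have [_ _ /(_ e eE)[F1 [F2 [_ H]]] _] := hG.
have := (H F).1 (conj fF eF); have := (H F').1 (conj fF' eF').
have := (H F'').1 (conj fF'' eF'').
by do 3![case=> ?]; subst; auto.
Qed.

(** * Turns of a zigzag, returns to a face, and excursions *)

Section Zigzag.
Context {z : nat -> oriented_edge G} (hz : oriented_zigzag z).

Lemma zigzag_edge_neq i : ends (z i) <> ends (z i.+1).
Proof.
move=> E; have [_ _ _ _ disj] := hz.1 i; have [_ [x [x1 x2]] _ _ _] := hz.1 i.+1.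
by apply: (disj x); rewrite E.
Qed.

Lemma zigzag_D i F : is_face G F -> Omega F (z i) -> Omega F (z i.+1) ->
  D F (z i) (z i.+1).
Proof.
move=> fF o1 o2; apply/DP => //; have E := hz.2 i; split=> // ac.
by apply: (@zigzag_edge_neq i); rewrite /ends E ac finset.setUC.
Qed.

(** The turns before and after [z i.+1] take place in distinct faces, and these are the only two
    faces containing that edge; F is exactly one of them. *)
Lemma zigzag_alternate i F : is_face G F -> Omega F (z i.+1) ->
  Omega F (z i) <-> ~ Omega F (z i.+2).
Proof.
move=> fF o1; have [_ _ [F1 f1 [e0 e1]] ne _] := hz.1 i.
have [_ _ [F2 f2 [e1' e2]] _ _] := hz.1 i.+1; split=> [h0 h2|h2].
  exact: (ne F F).
have ne12 : F1 <> F2 by apply: ne.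
by have [->|E] := edge_faces f1 f2 fF ne12 e1 e1' o1; last by case: h2; rewrite E.
Qed.

(** If the turn before the edge were in F and the one after it not in F', alternation would give F
    and F' two distinct common edges; the converse is symmetric. *)
Lemma zigzag_cross i F F' : is_face G F -> is_face G F' -> F <> F' ->
  Omega F (z i.+1) -> Omega F' (z i.+1) -> Omega F (z i) <-> Omega F' (z i.+2).
Proof.
move=> fF fF' FF' o o'; split=> [hi|hi2].
- apply: contrapT => /(zigzag_alternate fF' o') oi'.
  exact: (zigzag_edge_neq (shared_edge_eq fF fF' FF' hi oi' o o')).
- apply/(zigzag_alternate fF o) => oi.
  exact: (zigzag_edge_neq (shared_edge_eq fF fF' FF' o o' oi hi2)).
Qed.

End Zigzag.

Implicit Types (z : nat -> oriented_edge G).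

Lemma oriented_zigzag_shift z i : oriented_zigzag z ->
  oriented_zigzag (fun k => z (i + k)).
Proof.
by move=> [zz zo]; split=> k; [have := zz (i + k) | have := zo (i + k)]; rewrite -?addnS.
Qed.

(** The next turn happens in the other face at [z i.+1], where [D] is a function. *)
Lemma zigzag_ext z z' : oriented_zigzag z -> oriented_zigzag z' ->
  z 0 = z' 0 -> z 1 = z' 1 -> z =1 z'.
Proof.
move=> hz hz' E0 E1 i.
suff: z i = z' i /\ z i.+1 = z' i.+1 by case.
elim: i => [//|i [Ei Ei1]]; split=> //.
have [_ _ [F fF [e0 e1]] ne _] := hz.1 i.
have [_ _ [H fH [e1' e2]] _ _] := hz.1 i.+1.
have FH : F <> H by apply: ne.
apply: (@D_fun H (z i.+1)); first exact: zigzag_D.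
rewrite Ei1; apply: zigzag_D => //; first by rewrite -Ei1.
by apply/(zigzag_cross hz' fF fH FH); rewrite -?Ei -?Ei1.
Qed.

(** Alternation is used at both ends: the edge following a turn inside F is off F, and an edge of F
    reached from outside is followed by another one. *)
Lemma first_return z F n : oriented_zigzag z -> is_face G F ->
  Omega F (z 0) -> Omega F (z 1) -> (1 < n) -> Omega F (z n) ->
  (forall k, 1 < k < n -> ~ Omega F (z k)) -> 2 < n /\ D F (z n) (z n.+1).
Proof.
move=> hz fF o0 o1 n1 on out.
have n2 : 2 < n.
  rewrite ltn_neqAle n1 andbT; apply/eqP => n2; subst n.
  by move: on; apply/(zigzag_alternate hz fF o1).
split=> //; apply: zigzag_D => //; apply: contrapT.
case: n n2 out on {n1} => // n n2 out on.
by move/(zigzag_alternate hz fF on); apply: out; rewrite ltnSn andbT.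
Qed.

(** Any later visit to F, at time j, bounds the first return; this is what nests the returns to one
    face inside an excursion of its neighbour. The count n starts at [z i], one edge before the
    argument of the monodromy. *)
Lemma zigzag_return z F i j : oriented_zigzag z -> is_face G F ->
  Omega F (z i) -> Omega F (z i.+1) -> i.+1 < j -> Omega F (z j) ->
  exists n, [/\ 2 < n, i + n <= j, z_monodromy F (z i.+1) (z (i + n))
    & D F (z (i + n)) (z (i + n).+1)].
Proof.
move=> hz fF oi oi1 ij oj.
pose p n := (1 < n) && (ends (z (i + n)) \in face_edges G F).
have ex : exists n, p n.
  exists (j - i); rewrite /p subnKC; last by apply: ltnW; apply: ltnW.
  by rewrite oj andbT ltn_subRL addn1.
have [n /andP[n1 on] min] := find_ex_minn ex.
have hzi := oriented_zigzag_shift i hz.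
have out k : 1 < k < n -> ~ Omega F (z (i + k)).
  by move=> /andP[k1 kn] ok; have := min k; rewrite /p k1 ok leqNgt kn => /(_ isT).
have [] := @first_return _ F n hzi fF _ _ n1 on out.
- by rewrite addn0.
- by rewrite addn1.
rewrite addnS => n2 Dn; exists n; split=> //.
  rewrite -leq_subRL; last by apply: ltnW; apply: ltnW.
  apply: min; rewrite /p subnKC; last by apply: ltnW; apply: ltnW.
  by rewrite oj andbT ltn_subRL addn1.
exists (z i), (fun k => z (i + k)), n; rewrite addn0 addn1; split=> //.
exact: zigzag_D.
Qed.

(** A stretch of zigzag from the turn u0, u to the turn v, w, with n steps from u0 to v. It names no
    face and need not end at a first return, so stretches cut out of a longer zigzag qualify. *)
Definition excursion (u0 u v w : oriented_edge G) (n : nat) : Prop :=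
  exists z, [/\ oriented_zigzag z, z 0 = u0 /\ z 1 = u, 1 < n
    & z n = v /\ z n.+1 = w].

Lemma excursion_shift z i n : oriented_zigzag z -> 1 < n ->
  excursion (z i) (z i.+1) (z (i + n)) (z (i + n).+1) n.
Proof.
move=> hz n1; exists (fun k => z (i + k)).
by rewrite addn0 addn1 addnS; split=> //; apply: oriented_zigzag_shift.
Qed.

Lemma monodromy_excursion F u0 u v w : is_face G F -> D F u0 u -> D F v w ->
  z_monodromy F u v -> exists n, excursion u0 u v w n.
Proof.
move=> fF Du Dv [u0' [z [n [Du' hz [z0 z1] [n1 zn on] out]]]].
rewrite -{Du'}(D_inj Du Du') in z0.
have [h0 h1 _ _] := (DP u0 u fF).1 Du.
have := @first_return z F n hz fF; rewrite z0 z1 zn => /(_ h0 h1 n1 on out)[_ Dw]. exists n, z; split=> //; split=> //; exact: D_fun Dw Dv.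
Qed.

(** * Triangles with ordered vertices, and cycles in the dual graph *)

Definition triangle F a b c : Prop :=
  uniq [:: a; b; c] /\ face_verts G F = [set a; b; c]%SET.

Lemma triangle_rot F a b c : triangle F a b c -> triangle F b c a.
Proof.
move=> [us E]; split; first by rewrite -(rot_uniq 2).
by rewrite E [RHS]finset.setUC finset.setUA.
Qed.

Lemma triangle_D F a b c : triangle F a b c -> D F (a, b) (b, c).
Proof. by move=> [us E]; exists a, b, c. Qed.

Lemma triangle_edge F b c : is_face G F -> [set b; c]%SET \in face_edges G F ->
  exists d, triangle F b c d.
Proof.
move=> fF /(OmegaP (b, c) fF)[/= bV cV /eqP bc].
have /card_gt0P[d] : 0 < #|face_verts G F :\: [set b; c]|.
  rewrite finset.cardsD (finset.setIidPr _) ?finset.cards2 ?bc ?card_face_verts //.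
  by rewrite finset.subUset !finset.sub1set bV.
rewrite finset.in_setD finset.in_set2 negb_or => /andP[/andP[db dc] dV]; exists d.
have us : uniq [:: b; c; d] by rewrite /= !inE negb_or bc eq_sym db eq_sym dc.
split=> //; apply/esym/eqP; rewrite eqEcard; apply/andP; split.
  by rewrite !finset.subUset !finset.sub1set dV bV cV.
rewrite card_face_verts // -finset.setUA finset.cardsU1 finset.cards2 !inE negb_or.
by rewrite bc eq_sym db eq_sym dc.
Qed.

Lemma triangle_edges F b c d e : is_face G F -> triangle F b c d ->
  e \in face_edges G F ->
  [\/ e = [set b; c]%SET, e = [set c; d]%SET | e = [set d; b]%SET].
Proof.
move=> fF [us E]; rewrite face_edgesE // E => /andP[sub /finset.cards2P[p [q [pq def_e]]]].
move: sub pq; rewrite def_e finset.subUset !finset.sub1set !inE -!orbA => /andP[].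
have sw (x y : vert G) : [set x; y]%SET = [set y; x]%SET := finset.setUC _ _.
by do 2![case/or3P=> /eqP->]; rewrite ?eqxx ?(sw c b) ?(sw d c) ?(sw b d) // => _;
  constructor.
Qed.

(* [P a b c n] is a measure [n] attached to leaving the face abc across bc. *)
Lemma no_dual_cycle (A : set M -> Prop) (P : vert G -> vert G -> vert G -> nat -> Prop) :
  (forall F a b c, is_face G F -> A F -> triangle F a b c -> exists n, P a b c n) ->
  (forall F F' a b c d n, is_face G F -> is_face G F' -> F <> F' -> A F' ->
     triangle F a b c -> triangle F' b c d -> P a b c n ->
     (exists2 n', n' < n & P b c d n') /\ (exists2 n', n' < n & P c d b n')) ->
  forest (induced_subgraph (dual_adj G) [set F | is_face G F /\ A F]).
Proof.
move=> start step s s2 us cs.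
have [F0 F0s] : exists F0, F0 \in s.
  by case: s s2 {us cs} => // F0 s _; exists F0; apply: mem_head.
pose f i := iter i (next s) F0.
have fs i : f i \in s by elim: i => //= i; rewrite mem_next.
have f_adj i : induced_subgraph (dual_adj G) [set F | is_face G F /\ A F] (f i) (f i.+1).
  by apply/asboolP; apply: (next_cycle cs (fs i)).
have f2 i : f i.+2 <> f i by apply/eqP; apply: next_next_neq.
(* Every value of the measure is refuted by strong induction, for all positions on the endless walk
   around the cycle at once. *)
suff none n : forall i a b c, triangle (f i) a b c ->
    [set b; c]%SET \in face_edges G (f i.+1) -> ~ P a b c n.
  have [[fF aF] _ [_ fF' _ [e [eF eF']]]] := f_adj 0.
  have [] := (face_edgesP _ _).1 eF => /card_edge/eqP/finset.cards2P[b [c [_ def_e]]] _.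
  subst e.
  have [a ta] := triangle_edge fF eF; have ta' := triangle_rot (triangle_rot ta).
  have [n Pn] := start _ _ _ _ fF aF ta'.
  exact: (none n _ _ _ _ ta' eF' Pn).
elim/ltn_ind: n => n IH i a b c ti bcF' Pn.
have [[fF aF] [fF' aF'] [_ _ FF' [e [eF eF']]]] := f_adj i.
have [_ [fF'' _] [_ _ FF'' [e' [e'F' e'F'']]]] := f_adj i.+1.
have [d td] := triangle_edge fF' bcF'.
have [[n1 n1n P1] [n2 n2n P2]] := step _ _ _ _ _ _ _ fF fF' FF' aF' ti td Pn.
have bcF : [set b; c]%SET \in face_edges G (f i).
  by have [_ ] := (DP _ _ fF).1 (triangle_D ti).
(* Leaving F' through bc would lead back to F or stay in F'; cd and db are covered by the two halves
   of [step]. *)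
have [E|E|E] := triangle_edges fF' td e'F'; subst e'.
- have [E|E] := edge_faces fF fF' fF'' FF' bcF bcF' e'F''; first exact: f2 E.
  by apply: FF''; rewrite E.
- exact: (IH n1 n1n _ _ _ _ td e'F'').
- exact: (IH n2 n2n _ _ _ _ (triangle_rot td) e'F'').
Qed.

(** * Strict decrease of return times, for the identity and for D_F *)

Lemma id_excursion F a b c : is_face G F -> z_monodromy_is_id G F ->
  triangle F a b c -> exists n, excursion (a, b) (b, c) (b, c) (c, a) n.
Proof.
move=> fF idF t; have Dab := triangle_D t; have Dbc := triangle_D (triangle_rot t).
apply: (monodromy_excursion fF Dab Dbc); apply/idF; split=> //.
by have [] := (DP _ _ fF).1 Dbc.
Qed.

Lemma D_excursion F a b c : is_face G F -> z_monodromy_is_D G F ->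
  triangle F a b c -> exists n, excursion (b, c) (c, a) (a, b) (b, c) n.
Proof.
move=> fF DF t; have t' := triangle_rot t.
apply: (monodromy_excursion fF (triangle_D t') (triangle_D t)); apply/DF.
exact: triangle_D (triangle_rot t').
Qed.

(** In F' the zigzag turns from bc to cd at the start and from db to bc at the end. The remaining
    turn, from cd to db, falls in between and separates two successive returns to F', both inside
    the excursion. *)
Lemma id_step F F' a b c d n : is_face G F -> is_face G F' -> F <> F' ->
  z_monodromy_is_id G F' -> triangle F a b c -> triangle F' b c d ->
  excursion (a, b) (b, c) (b, c) (c, a) n ->
  (exists2 n', n' < n & excursion (b, c) (c, d) (c, d) (d, b) n') /\
  (exists2 n', n' < n & excursion (c, d) (d, b) (d, b) (b, c) n').
Proof.
move=> fF fF' FF' idF' t t' [z [hz [z0 z1] n1 [zn zn1]]].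
case: n n1 zn zn1 => // m; rewrite ltnS => m0 zn zn1.
have Dbc := triangle_D t'; have Dcd := triangle_D (triangle_rot t').
have Ddb := triangle_D (triangle_rot (triangle_rot t')).
have [oab obc _ _] := (DP _ _ fF).1 (triangle_D t).
have [_ oca _ _] := (DP _ _ fF).1 (triangle_D (triangle_rot t)).
have [obc' ocd' _ _] := (DP _ _ fF').1 Dbc.
have [odb' _ _ _] := (DP _ _ fF').1 Ddb.
have [us' _] := t'.
have [bd cd] : b <> d /\ c <> d.
  move: us'; rewrite /= !inE negb_or => /and3P[/andP[_ /eqP ?] /eqP ? _].
  by split.
(* The zigzag reaches bc out of F, so it goes on in F'; at the other end it goes on in F, so it
   reached bc out of F'. *)
have z2 : z 2 = (c, d).
  apply: (@D_fun F' (b, c)) => //; rewrite -z1; apply: zigzag_D; rewrite ?z1 //.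
  by apply/(zigzag_cross hz fF fF' FF'); rewrite ?z0 ?z1.
have zm : z m = (d, b).
  apply: (@D_inj F' _ _ (b, c)) => //; rewrite -zn; apply: zigzag_D; rewrite ?zn //.
  by apply/(zigzag_cross hz fF' fF (not_eq_sym FF')); rewrite ?zn ?zn1.
(* Times 1 and 2 are taken by bc and cd, so db at time m is a later visit to F' and bounds the first
   return. *)
have m2 : 2 < m.
  case: m m0 zm {zn zn1} => [|[|[|m]]] // _; first by rewrite z1 => -[/bd].
  by rewrite z2 => -[/cd].
have [n1 [n1_2 n1m mon1 D1]] : exists n, [/\ 2 < n, 1 + n <= m,
    z_monodromy F' (z 2) (z (1 + n)) & D F' (z (1 + n)) (z (1 + n).+1)].
  by apply: zigzag_return; rewrite ?z1 ?z2 ?zm.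
have z1n1 : z (1 + n1) = (c, d) by have [] := (idF' _ _).1 mon1; rewrite z2.
have z2n1 : z (1 + n1).+1 = (d, b) by apply: D_fun Dcd; rewrite -z1n1.
(* Were this turn to end at time m, the consecutive edges cd, db, bc would all lie in F', against
   alternation. *)
have n1m' : (1 + n1).+1 < m.
  rewrite ltn_neqAle; apply/andP; split.
    apply/eqP => E; have := zigzag_alternate hz (i := 1 + n1) fF'.
    by rewrite z1n1 z2n1 E zn => /(_ odb')[/(_ ocd')].
  rewrite ltn_neqAle n1m andbT; apply/eqP => E.
  by move: z1n1; rewrite E zm => -[/esym/cd].
have [n2 [n2_2 n2m mon2 D2]] : exists n, [/\ 2 < n, 1 + n1 + n <= m,
    z_monodromy F' (z (1 + n1).+1) (z (1 + n1 + n))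
    & D F' (z (1 + n1 + n)) (z (1 + n1 + n).+1)].
  by apply: zigzag_return; rewrite ?z1n1 ?z2n1 ?zm.
have z1n2 : z (1 + n1 + n2) = (d, b) by have [] := (idF' _ _).1 mon2; rewrite z2n1.
have z2n2 : z (1 + n1 + n2).+1 = (b, c) by apply: D_fun Ddb; rewrite -z1n2.
split; [exists n1|exists n2]; [lia| |lia|].
- by have := @excursion_shift z 1 n1 hz; rewrite z1 z2 z1n1 z2n1; apply; lia.
- by have := @excursion_shift z (1 + n1) n2 hz; rewrite z1n1 z2n1 z1n2 z2n2; apply; lia.
Qed.

(** Extended back by the edge db, the given zigzag shows two successive returns to F': from db, bc
    to cd, db, then on to bc, cd. Their lengths add up to at most n + 2 and each exceeds 2, so each
    is below n. *)
Lemma D_step F F' a b c d n : is_face G F -> is_face G F' -> F <> F' ->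
  z_monodromy_is_D G F' -> triangle F a b c -> triangle F' b c d ->
  excursion (b, c) (c, a) (a, b) (b, c) n ->
  (exists2 n', n' < n & excursion (c, d) (d, b) (b, c) (c, d) n') /\
  (exists2 n', n' < n & excursion (d, b) (b, c) (c, d) (d, b) n').
Proof.
move=> fF fF' FF' DF' t t' [y [hy [y0 y1] n1 [yn yn1]]].
have Dbc := triangle_D t'; have Dcd := triangle_D (triangle_rot t').
have Ddb := triangle_D (triangle_rot (triangle_rot t')).
have [oab obc _ _] := (DP _ _ fF).1 (triangle_D t).
have [_ oca _ _] := (DP _ _ fF).1 (triangle_D (triangle_rot t)).
have [obc' ocd' _ _] := (DP _ _ fF').1 Dbc.
have [odb' _ _ _] := (DP _ _ fF').1 Ddb.
have [us' _] := t'.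
have [bd cd] : b <> d /\ c <> d.
  move: us'; rewrite /= !inE negb_or => /and3P[/andP[_ /eqP ?] /eqP ? _].
  by split.
(* This supplies a zigzag through db, bc; by uniqueness it is the given one preceded by db, so times
   shift by one. *)
have [_ [z [hz [z0 z1] _ _]]] := D_excursion fF' DF' (triangle_rot t').
have z2 : z 2 = (c, a).
  apply: (@D_fun F (b, c)); last exact: triangle_D (triangle_rot t).
  rewrite -z1; apply: zigzag_D; rewrite ?z1 //.
  by apply/(zigzag_cross hz fF' fF (not_eq_sym FF')); rewrite ?z0 ?z1.
have zy k : z k.+1 = y k.
  apply: (zigzag_ext (oriented_zigzag_shift 1 hz) hy).
    by rewrite addn0 z1 y0.
  by rewrite addn1 z2 y1.
have zn1 : z n.+1 = (a, b) by rewrite zy.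
have zn2 : z n.+2 = (b, c) by rewrite zy.
(* As bc is the only common edge, the zigzag is off F' at time n + 1, which keeps the turn from cd
   to db clear of the end. *)
have oab' : ~ Omega F' (a, b).
  move=> oab'; apply: (@zigzag_edge_neq z hz n.+1); rewrite zn1 zn2.
  exact: shared_edge_eq fF fF' FF' oab oab' obc obc'.
have [m [m2 mn mon1 D1]] : exists m, [/\ 2 < m, 0 + m <= n.+2,
    z_monodromy F' (z 1) (z (0 + m)) & D F' (z (0 + m)) (z (0 + m).+1)].
  by apply: zigzag_return; rewrite ?z0 ?z1 ?zn2.
rewrite add0n in mn mon1 D1.
have zm : z m = (c, d) by apply: D_fun Dbc; rewrite -z1; apply/DF'.
have zm1 : z m.+1 = (d, b) by apply: D_fun Dcd; rewrite -zm.
have mn' : m.+1 < n.+2.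
  have m_n2 : m <> n.+2 by move=> E; move: zm; rewrite E zn2 => -[_ /cd].
  have m_n1 : m <> n.+1 by move=> E; apply: oab'; rewrite -zn1 -E zm.
  have m_n : m <> n by move=> E; apply: oab'; rewrite -zn1 -E zm1.
  by lia.
have [k [k2 kn mon2 D2]] : exists k, [/\ 2 < k, m + k <= n.+2,
    z_monodromy F' (z m.+1) (z (m + k)) & D F' (z (m + k)) (z (m + k).+1)].
  by apply: zigzag_return; rewrite ?zm ?zm1 ?zn2.
have zk : z (m + k) = (b, c) by apply: D_fun Ddb; rewrite -zm1; apply/DF'.
have zk1 : z (m + k).+1 = (c, d) by apply: D_fun Dbc; rewrite -zk.
split; [exists k|exists m]; [lia| |lia|].
- by have := @excursion_shift z m k hz; rewrite zm zm1 zk zk1; apply; lia.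
- by have := @excursion_shift z 0 m hz; rewrite z0 z1 add0n zm zm1; apply; lia.
Qed.

End Triangulation.

Unset Implicit Arguments.

Theorem theorem1 (R : realType) (M : topologicalType)
    (hM : closed_surface R M) (G : embedded_graph R M) (hG : triangulation G) :
  forest (induced_subgraph (dual_adj G)
            [set F | is_face G F /\ z_monodromy_is_id G F]) /\
  forest (induced_subgraph (dual_adj G)
            [set F | is_face G F /\ z_monodromy_is_D G F]).
Proof.
split.
- apply: (no_dual_cycle hG
    (P := fun a b c => excursion (a, b) (b, c) (b, c) (c, a))).
  + exact: id_excursion.
  + exact: id_step.
- apply: (no_dual_cycle hG
    (P := fun a b c => excursion (b, c) (c, a) (a, b) (b, c))).
  + exact: D_excursion.
  + exact: D_step.
Qed.
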